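(* Let $H$ be a connected graph. Then $\mathsf{SOEI}(H)\ge 2|V(H)|-|E(H)|-2$.
   Context: Let $H$ be a connected (finite, simple) graph on $k$ vertices and $\pi$ a bijective labelling of its vertices by $\{1,\dots,k\}$; identify vertices with labels and write an edge between $u$ and $v$ as $(uv)$ when $u>v$. For $F\subseteq E(H)$ and a vertex $v$, let $F^{\pi}_{\ge v}$ be the set of edges of $F$ with both endpoints at least $v$, and let $F^\pi_{\ge v,\ni u}$ be the connected component of $F^\pi_{\ge v}$ containing $u$. An edge $(uv)\in E(H)\setminus F$ (with $u>v$) is strongly covered by $F$ if $v$ has a neighbour in $H$, other than $u$, belonging to $V(F^\pi_{\ge v,\ni u})$. Let $\overline{\partial}^{\,\pi}_HF$ be the set of edges strongly covered by $F$. $\mathsf{SOEI}_\pi(H)$ is the minimal cardinality of $F\subseteq E(H)$ with $F\cup\overline{\partial}^{\,\pi}_HF=E(H)$, and $\mathsf{SOEI}(H)=\max_\pi\mathsf{SOEI}_\pi(H)$. *)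

(* Defs.v *)
From mathcomp Require Import all_boot all_order all_algebra.

Set Implicit Arguments.
Unset Strict Implicit.
Unset Printing Implicit Defensive.

(* A finite simple graph is a symmetric irreflexive relation [e : rel T] on a
   finType [T]; its edges are the two-element vertex sets [set x; y]. *)
Definition edges (T : finType) (e : rel T) : {set {set T}} :=
  [set [set p.1; p.2] | p : T * T & e p.1 p.2].

Definition connected_graph (T : finType) (e : rel T) : Prop :=
  forall x y : T, connect e x y.

(* Labels live in {0, ..., k-1} instead of {1, ..., k}: only their order
   matters. By cardinality, injective labellings are exactly the bijective
   ones. *)
Definition labelling (T : finType) := {ffun T -> 'I_#|T|}.

Definition edges_ge (T : finType) (pi : labelling T) (F : {set {set T}})
    (v : T) : {set {set T}} :=
  [set A in F | [forall x in A, pi v <= pi x]].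

Definition edge_adj (T : finType) (F : {set {set T}}) : rel T :=
  [rel x y | [set x; y] \in F].

(* When no edge of F_{>=v} meets u this is [set u] rather than empty; this is
   immaterial below, where u itself is excluded. *)
Definition component_vertices (T : finType) (pi : labelling T)
    (F : {set {set T}}) (v u : T) : {set T} :=
  [set w | connect (edge_adj (edges_ge pi F v)) u w].

Definition strongly_covered (T : finType) (e : rel T) (pi : labelling T)
    (F : {set {set T}}) (u v : T) : bool :=
  [exists w, [&& e v w, w != u & w \in component_vertices pi F v u]].

Definition strong_boundary (T : finType) (e : rel T) (pi : labelling T)
    (F : {set {set T}}) : {set {set T}} :=
  [set A in edges e :\: F | [exists u, exists v,
     [&& A == [set u; v], pi v < pi u & strongly_covered e pi F u v]]].

Definition strongly_covering (T : finType) (e : rel T) (pi : labelling T)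
    (F : {set {set T}}) : bool :=
  (F \subset edges e) && (F :|: strong_boundary e pi F == edges e).

Lemma strongly_covering_edges (T : finType) (e : rel T) (pi : labelling T) :
  strongly_covering e pi (edges e).
Proof.
rewrite /strongly_covering subxx; apply/eqP/setUidPl/subsetP => A.
by rewrite !inE => /andP[/andP[_ ->]].
Qed.

(* The minimum ranges over a nonempty family, by [strongly_covering_edges]. *)
Definition SOEI_pi (T : finType) (e : rel T) (pi : labelling T) : nat :=
  #|[arg min_(F < edges e | strongly_covering e pi F) #|F|]|.

Definition SOEI (T : finType) (e : rel T) : nat :=
  \max_(pi : labelling T | injectiveb pi) SOEI_pi e pi.

(* Main.v *)
Require Import Defs.
From mathcomp Require Import all_boot all_order all_algebra.
From mathcomp Require Import zify.

Set Implicit Arguments.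
Unset Strict Implicit.
Unset Printing Implicit Defensive.

(** The bound holds for every labelling, not only for the best one: if [F] is
strongly covering and [E] is the set of edges, then [2 * #|T| <= #|F| + #|E| + 2].

Give weight 2 to the edges of [F] and weight 1 to the other edges, so that the
total weight is [#|F| + #|E|], and grow a vertex set [S] from a single vertex,
one vertex at a time, so that each new vertex adds weight at least 2 inside [S],
up to a debt of one unit that is repaid later.
- If an edge of [F] leaves [S], its outer endpoint brings weight 2.
- Otherwise [S] is a union of components of [F], and some edge [xy], not in [F],
  leaves [S], because the graph is connected.  It is strongly covered, so its
  endpoint with the smaller label has a second neighbour [w] in the
  [F]-component of the other endpoint.  If the smaller endpoint is the outer
  one, then [w] lies in [S] and the new vertex brings two edges.  If it is the
  inner endpoint [x], then [w] lies outside [S], and adding [y] brings only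
  weight 1; but the edge [xw] is still to come: as [w] is joined to [y] by
  edges of [F], edges of [F] will leave [S] until [w] is added, and at that
  moment [xw] repays the missing unit.
The possible debt is part of the invariant [balanced]; when [S] is
the whole vertex set there is no outer [w], hence no debt. *)

(** A path from inside [S] to outside [S] contains a step leaving [S]. *)
Lemma connect_leave (T : finType) (r : rel T) (S : {set T}) (a b : T) :
  connect r a b -> a \in S -> b \notin S ->
  exists x y, [/\ x \in S, y \notin S & r x y].
Proof.
move=> /connectP[p]; elim: p a => [|c p IHp] a /=.
  by move=> _ -> ->.
case/andP=> rac rp eb aS bNS; case: (boolP (c \in S)) => cS.
  exact: (IHp c).
by exists a, c.
Qed.

Lemma edge_adj_sym (T : finType) (F : {set {set T}}) : symmetric (edge_adj F).
Proof. by move=> x y; rewrite /edge_adj /= setUC. Qed.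

Lemma mem_edges (T : finType) (e : rel T) (x y : T) :
  e x y -> [set x; y] \in edges e.
Proof. by move=> exy; apply/imsetP; exists (x, y); rewrite ?inE. Qed.

(** The component used for strong coverage lies in a component of all of [F]. *)
Lemma component_connect (T : finType) (pi : labelling T) (F : {set {set T}})
    (u v w : T) :
  w \in component_vertices pi F v u -> connect (edge_adj F) u w.
Proof.
rewrite inE; apply: connect_sub => x y; rewrite /edge_adj /= inE => /andP[xyF _].
exact: connect1.
Qed.

(** The number of edges of [A] with both endpoints in [S]. *)
Definition inner_size (T : finType) (A : {set {set T}}) (S : {set T}) : nat :=
  #|[set B in A | B \subset S]|.

Lemma inner_size_add (T : finType) (A D : {set {set T}}) (S : {set T})
    (y : T) :
  y \notin S -> D \subset A ->
  (forall B, B \in D -> (y \in B) && (B \subset y |: S)) ->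
  inner_size A S + #|D| <= inner_size A (y |: S).
Proof.
move=> yS /subsetP DA yD.
rewrite /inner_size; set inS := [set B in A | B \subset S].
have disj : [disjoint inS & D].
  apply/pred0P => B /=; apply/negP => /andP[].
  rewrite inE => /andP[_ /subsetP BS] /yD /andP[/BS yS' _].
  by rewrite yS' in yS.
have /eqP <- : #|inS :|: D| == #|inS| + #|D|.
  by rewrite (leq_card_setU _ _).2.
apply: subset_leq_card; apply/subsetP => B; rewrite !inE.
case/orP=> [/andP[-> BS] | BD]; last by rewrite DA // (andP (yD B BD)).2.
exact: subset_trans BS (subsetU1 y S).
Qed.

Lemma pair_sub_add (T : finType) (S : {set T}) (x y : T) :
  x \in S -> (y \in [set x; y]) && ([set x; y] \subset y |: S).
Proof.
by move=> xS; rewrite set22 subUset !sub1set !inE xS eqxx orbT.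
Qed.

(** Every edge outside a strongly covering [F] has an endpoint with a second
neighbour in the [F]-component of the other endpoint.  This is all that the
labelling contributes. *)
Lemma uncovered_neighbour (T : finType) (e : rel T) (pi : labelling T)
    (F : {set {set T}}) (x y : T) :
  strongly_covering e pi F -> e x y -> [set x; y] \notin F ->
  (exists w, [/\ e y w, w != x & connect (edge_adj F) x w]) \/
  (exists w, [/\ e x w, w != y & connect (edge_adj F) y w]).
Proof.
case/andP=> _ /eqP FE exy xyF; have := mem_edges exy.
rewrite -FE inE (negbTE xyF) /= inE => /andP[_].
case/existsP=> u /existsP[v /and3P[/eqP xyE ltvu /existsP[w /and3P[evw wu]]]].
move/component_connect=> uw.
have xu : u \in [set x; y] by rewrite xyE set21.
have xv : v \in [set x; y] by rewrite xyE set22.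
have uv : u != v by apply: contraTneq ltvu => ->; rewrite ltnn.
move: xu xv uv; rewrite !inE => /orP[] /eqP Eu /orP[] /eqP Ev uv; subst u v.
- by rewrite eqxx in uv.
- by left; exists w.
- by right; exists w.
- by rewrite eqxx in uv.
Qed.

(** [S] is balanced for the edge set [E] and its subset [F] if the edges inside
[S], those of [F] counted twice, have weight at least [2 (#|S| - 1)], where one
unit may be missing if an edge [xw] of [E], not in [F], leaves [S] towards a
vertex [w] that [F] joins to some vertex of [S]. *)
Definition balanced (T : finType) (E F : {set {set T}}) (S : {set T}) : Prop :=
  let weight := inner_size F S + inner_size E S in
  2 * #|S| <= weight + 2 \/
  2 * #|S| <= weight + 3 /\
  exists a x w, [/\ a \in S, x \in S, w \notin S, connect (edge_adj F) a w
                 & ([set x; w] \in E) && ([set x; w] \notin F)].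

(** Adding the outer endpoint of an edge of [F] keeps the set balanced. *)
Lemma balanced_add_covering (T : finType) (E F : {set {set T}}) (S : {set T})
    (x y : T) :
  F \subset E -> x \in S -> y \notin S -> [set x; y] \in F ->
  balanced E F S -> balanced E F (y |: S).
Proof.
move=> FE xS yS xyF; have xyE := subsetP FE _ xyF.
have pS B : B \in [set [set x; y]] -> (y \in B) && (B \subset y |: S).
  by move=> /set1P->; apply: pair_sub_add.
have gF : inner_size F S + 1 <= inner_size F (y |: S).
  rewrite -(cards1 [set x; y]); apply: inner_size_add => //.
  by rewrite sub1set.
have gE : inner_size E S + 1 <= inner_size E (y |: S).
  rewrite -(cards1 [set x; y]); apply: inner_size_add => //.
  by rewrite sub1set.
rewrite /balanced cardsU1 yS /=.
case=> [le | [le [a [z [w [aS zS wS aw /andP[zwE zwF]]]]]]]; first by left; lia.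
case: (eqVneq w y) => [wy | wy]; last first.
  right; split; first lia.
  by exists a, z, w; rewrite !inE aS zS (negbTE wy) zwE zwF !orbT.
(* The edge [zw] is now inside and, as it is not in [F], differs from [xy]. *)
left; subst w.
suff : inner_size E S + 2 <= inner_size E (y |: S) by lia.
have -> : 2 = #|[set [set x; y]; [set z; y]]|.
  by rewrite cards2; case: eqVneq => // xz; rewrite -xz xyF in zwF.
apply: inner_size_add => //; first by rewrite subUset !sub1set xyE.
by move=> B; rewrite !inE => /orP[] /eqP->; move: (@pair_sub_add T S);
  [move/(_ x y xS) | move/(_ z y zS)]; rewrite !inE.
Qed.

(** A proper nonempty balanced set extends by one vertex to a balanced set. *)
Lemma balanced_grow (T : finType) (e : rel T) (pi : labelling T)
    (F : {set {set T}}) (S : {set T}) (a b : T) :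
  symmetric e -> connected_graph e -> strongly_covering e pi F ->
  a \in S -> b \notin S -> balanced (edges e) F S ->
  exists2 y, y \notin S & balanced (edges e) F (y |: S).
Proof.
move=> e_sym e_conn covF aS bS balS; have [FE _] := andP covF.
case: (boolP [exists x, exists y, [&& x \in S, y \notin S & [set x; y] \in F]]).
  case/existsP=> x /existsP[y /and3P[xS yS xyF]]; exists y => //.
  exact: balanced_add_covering xyF balS.
move=> noF.
(* [S] is now a union of components of [F]. *)
have Fclosed x y : x \in S -> y \notin S -> ~ connect (edge_adj F) x y.
  move=> xS yS /connect_leave/(_ xS yS)[c [d [cS dS cd]]].
  by case/existsP: noF; exists c; apply/existsP; exists d; rewrite cS dS.
(* Hence there is no outstanding debt. *)
have {balS} le : 2 * #|S| <= inner_size F S + inner_size (edges e) S + 2.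
  case: balS => // -[_ [c [_ [w [cS _ wS cw _]]]]].
  by case: (Fclosed _ _ cS wS cw).
have [x [y [xS yS exy]]] := connect_leave (e_conn a b) aS bS.
have xyF : [set x; y] \notin F.
  apply/negP => xyF; apply: (Fclosed x y) => //; exact: connect1.
exists y => //; rewrite /balanced cardsU1 yS /=.
have gF : inner_size F S <= inner_size F (y |: S).
  rewrite -[leqLHS]addn0 -(cards0 {set T}).
  by apply: inner_size_add => [//||B]; rewrite ?sub0set ?inE.
case: (uncovered_neighbour covF exy xyF) => -[w [ew wxy xw]].
(* The second neighbour [w] of the outer endpoint [y] lies in [S]. *)
- have wS : w \in S by apply/negPn/negP => wS; apply: (Fclosed x w).
  left; suff : inner_size (edges e) S + 2 <= inner_size (edges e) (y |: S).
    by clear -le gF; lia.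
  have -> : 2 = #|[set [set x; y]; [set w; y]]|.
    rewrite cards2; case: eqVneq => // /setP/(_ w).
    by rewrite !inE eqxx (negbTE wxy) /= => /eqP wy; rewrite -wy wS in yS.
  apply: inner_size_add => //.
    by rewrite subUset !sub1set !mem_edges // e_sym.
  by move=> B /set2P[] ->; apply: pair_sub_add.
(* The second neighbour [w] of the inner endpoint [x] is outside: a debt. *)
- have wS : w \notin S.
    apply/negP => wS; apply: (Fclosed w y) => //.
    by rewrite (sym_connect_sym (@edge_adj_sym T F)).
  have xwF : [set x; w] \notin F.
    apply/negP => xwF; apply: (Fclosed x w) => //; exact: connect1.
  right; split; last first.
    exists y, x, w; rewrite !inE eqxx xS (negbTE wS) (negbTE wxy).
    by rewrite mem_edges // xwF orbT.
  suff : inner_size (edges e) S + 1 <= inner_size (edges e) (y |: S).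
    by clear -le gF; lia.
  rewrite -(cards1 [set x; y]); apply: inner_size_add => //.
    by rewrite sub1set mem_edges.
  by move=> B /set1P->; apply: pair_sub_add.
Qed.

(** The bound for a single labelling, which need not be injective. *)
Lemma strongly_covering_card (T : finType) (e : rel T) (pi : labelling T)
    (F : {set {set T}}) :
  symmetric e -> connected_graph e -> strongly_covering e pi F ->
  2 * #|T| <= #|F| + #|edges e| + 2.
Proof.
move=> e_sym e_conn covF; case: (posnP #|T|) => [->|T_gt0]; first lia.
have [r _] := card_gt0P T_gt0.
have grow n : n < #|T| ->
    exists S : {set T}, #|S| = n.+1 /\ balanced (edges e) F S.
  elim: n => [_ | n IHn ltn].
    by exists [set r]; rewrite /balanced cards1; split=> //; left; lia.
  have [S [cS balS]] := IHn (ltnW ltn).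
  have [a aS] : exists a, a \in S by apply/card_gt0P; rewrite cS.
  have [b bS] : exists b, b \in ~: S.
    by apply/card_gt0P; have := cardsC S; lia.
  rewrite inE in bS.
  have [y yS balyS] := balanced_grow e_sym e_conn covF aS bS balS.
  by exists (y |: S); rewrite cardsU1 yS cS.
have [|S [cS balS]] := grow #|T|.-1; first lia.
have ST : S = [set: T].
  by apply/eqP; rewrite eqEcard subsetT cardsT cS leqSpred.
have leF A : inner_size A S <= #|A|.
  by apply: subset_leq_card; apply/subsetP => B; rewrite inE => /andP[].
have := leF F; have := leF (edges e).
case: balS => [|[_ [a [x [w [_ _]]]]]]; last by rewrite ST inE.
by rewrite cS prednK //; lia.
Qed.

Theorem proposition1p4 (T : finType) (e : rel T)
    (e_sym : symmetric e) (e_irr : irreflexive e)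
    (e_conn : connected_graph e) :
  (2 * #|T|%:Z - #|edges e|%:Z - 2 <= (SOEI e)%:Z)%R.
Proof.
pose pi : labelling T := [ffun x => enum_rank x].
have pi_inj : injectiveb pi.
  by apply/injectiveP => x y; rewrite !ffunE => /enum_rank_inj.
have lePi : SOEI_pi e pi <= SOEI e by apply: leq_bigmax_cond.
have : 2 * #|T| <= SOEI_pi e pi + #|edges e| + 2.
  rewrite /SOEI_pi; case: arg_minnP => [|F covF _].
    exact: strongly_covering_edges.
  exact: strongly_covering_card covF.
lia.
Qed.
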